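(* Let $C_{10}$ be the smallest positive root of $50x^4-72x^3+22x^2-2x+1$ (so $C_{10}\approx0.4557$). For every triangle, the following bounds hold, where a bound $L\le \frac{D(n,i)}{D(n,j)}\le U$ means $L\,D(n,j)\le D(n,i)\le U\,D(n,j)$ (and similarly for one-sided bounds and equalities): $$\frac{D(10,1)}{D(10,2)}=3,\quad \frac{D(10,1)}{D(10,4)}\le1,\quad \frac{D(10,1)}{D(10,5)}\le2,\quad 2-\sqrt2\le\frac{D(10,1)}{D(10,6)}\le1,\quad \frac13\le\frac{D(10,1)}{D(10,7)}\le1,\quad \frac{D(10,1)}{D(10,8)}=1,\quad 1\le\frac{D(10,1)}{D(10,9)},$$ $$\frac{D(10,2)}{D(10,4)}\le\frac13,\quad \frac{D(10,2)}{D(10,5)}\le\frac23,\quad \frac13\left(2-\sqrt2\right)\le\frac{D(10,2)}{D(10,6)}\le\frac13,\quad \frac19\le\frac{D(10,2)}{D(10,7)}\le\frac13,\quad \frac{D(10,2)}{D(10,8)}=\frac13,\quad \frac13\le\frac{D(10,2)}{D(10,9)},$$ $$\frac{D(10,3)}{D(10,4)}\le\frac12,\quad \frac{D(10,3)}{D(10,5)}\le2,\quad 2\le\frac{D(10,3)}{D(10,9)},$$ $$2\le\frac{D(10,4)}{D(10,5)}\le4,\quad 1\le\frac{D(10,4)}{D(10,6)},\quad 1\le\frac{D(10,4)}{D(10,7)},\quad 1\le\frac{D(10,4)}{D(10,8)},\quad 9\le\frac{D(10,4)}{D(10,9)},$$ $$C_{10}\le\frac{D(10,5)}{D(10,6)},\quad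 \frac12\le\frac{D(10,5)}{D(10,7)},\quad \frac12\le\frac{D(10,5)}{D(10,8)},\quad \frac32+\sqrt2\le\frac{D(10,5)}{D(10,9)},$$ $$\frac59\le\frac{D(10,6)}{D(10,7)}\le\frac43,\quad 1\le\frac{D(10,6)}{D(10,8)}\le1+\frac1{\sqrt2},\quad \frac53\le\frac{D(10,6)}{D(10,9)},\quad 1\le\frac{D(10,7)}{D(10,8)}\le3,\quad 3\le\frac{D(10,7)}{D(10,9)},\quad 1\le\frac{D(10,8)}{D(10,9)}.$$
   Context: For a (nondegenerate) triangle $ABC$ with side lengths $a=BC$, $b=CA$, $c=AB$, a point with barycentric coordinates $(u:v:w)$ is $(uA+vB+wC)/(u+v+w)$. For $1\le n\le 10$ the triangle center $X_n$ is the point with barycentric coordinates $(f_n(a,b,c):f_n(b,c,a):f_n(c,a,b))$, where $f_1=a$ (incenter); $f_2=1$ (centroid); $f_3=a^2(a^2-b^2-c^2)$ (circumcenter); $f_4=(a^2+b^2-c^2)(a^2-b^2+c^2)$ (orthocenter); $f_5=c^4-a^2b^2+b^4-a^2c^2-2b^2c^2$ (nine-point center); $f_6=a^2$ (symmedian point); $f_7=(a+b-c)(a-b+c)$ (Gergonne point); $f_8=a-b-c$ (Nagel point); $f_9=a(a-b-c)$ (mittenpunkt); $f_{10}=b+c$ (Spieker center). $D(i,j)$ denotes the Euclidean distance between $X_i$ and $X_j$. *)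

(* Defs.v *)
From Stdlib Require Export Reals.
Open Scope R_scope.

Definition point : Type := (R * R)%type.

Definition edist (P Q : point) : R :=
  dist_euc (fst P) (snd P) (fst Q) (snd Q).

(* The left-hand side is twice the signed area of ABC. *)
Definition nondegenerate (A B C : point) : Prop :=
  (fst B - fst A) * (snd C - snd A) - (fst C - fst A) * (snd B - snd A) <> 0.

(* Meaningful when u + v + w <> 0, which holds for all the centers below
   whenever ABC is nondegenerate. *)
Definition barycentric (A B C : point) (u v w : R) : point :=
  ((u * fst A + v * fst B + w * fst C) / (u + v + w),
   (u * snd A + v * snd B + w * snd C) / (u + v + w)).

(* First barycentric coordinate of X_n, with Kimberling's numbering; the value
   for n = 0 or n > 10 is junk. *)
Definition center_fun (n : nat) (a b c : R) : R :=
  match n with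
  | 1%nat => a
  | 2%nat => 1
  | 3%nat => a^2 * (a^2 - b^2 - c^2)
  | 4%nat => (a^2 + b^2 - c^2) * (a^2 - b^2 + c^2)
  | 5%nat => c^4 - a^2 * b^2 + b^4 - a^2 * c^2 - 2 * b^2 * c^2
  | 6%nat => a^2
  | 7%nat => (a + b - c) * (a - b + c)
  | 8%nat => a - b - c
  | 9%nat => a * (a - b - c)
  | 10%nat => b + c
  | _ => 0
  end.

Definition center (A B C : point) (n : nat) : point :=
  let a := edist B C in
  let b := edist C A in
  let c := edist A B in
  barycentric A B C (center_fun n a b c) (center_fun n b c a)
    (center_fun n c a b).

Definition center_dist (A B C : point) (i j : nat) : R :=
  edist (center A B C i) (center A B C j).

Definition smallest_positive_root (p : R -> R) (r : R) : Prop :=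
  0 < r /\ p r = 0 /\ forall x : R, 0 < x -> p x = 0 -> r <= x.

(* Main.v *)
Require Import Defs.
From Stdlib Require Import Reals Lra Lia Psatz.
Open Scope R_scope.

(* Take the Spieker center X10 as origin, with v = X1 - X10 and w = X3 - X10.
   All the other centers are then combinations of v and w:
   X2 = v/3, X4 = v - 2w, X5 = (v - w)/2, X8 = -v, X9 = -t(v - 2w),
   X7 = v - 2 X9 and X6 = ((s^2 + r^2) v - 2 r^2 w) / (s^2 - r^2 - 4Rr), where
   t = r/(4R + r), R is the circumradius, r the inradius and s the
   semiperimeter.  With rho = r^2 and tau = r(R - 2r) the Gram matrix of v, w
   satisfies v.w = -tau/2 and rho(|v|^2 + |w|^2) = tau^2 + rho tau, and
   s^2 = 4|v|^2 + 27 rho + 16 tau; Cauchy-Schwarz for v and w is Blundon's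
   inequality.  These constraints are solved by a parametrization with x > 0 and
   p, q >= 0, the isosceles triangles being p q = 0.  In these parameters nearly
   every bound is a polynomial with nonnegative coefficients; the three bounds
   attained at an interior isosceles shape are reduced to that shape, where
   they become a square. *)

(** * Squared distances and the Ravi substitution *)

Lemma sq_edist (P Q : point) :
  edist P Q ^ 2 = (fst P - fst Q) ^ 2 + (snd P - snd Q) ^ 2.
Proof.
unfold edist, dist_euc; rewrite <- Rsqr_pow2, Rsqr_sqrt.
- unfold Rsqr; ring.
- apply Rplus_le_le_0_compat; apply Rle_0_sqr.
Qed.

Lemma edist_triangle (P Q T : point) : edist P Q <= edist P T + edist T Q.
Proof. apply triangle. Qed.
Lemma edist_sym (P Q : point) : edist P Q = edist Q P.
Proof. apply distance_symm. Qed.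

Lemma ravi (A B C : point) : nondegenerate A B C ->
  exists x y z : R, 0 < x /\ 0 < y /\ 0 < z /\
    edist B C = y + z /\ edist C A = z + x /\ edist A B = x + y.
Proof.
intros h; unfold nondegenerate in h.
pose proof (edist_triangle B C A) as ta.
pose proof (edist_triangle C A B) as tb.
pose proof (edist_triangle A B C) as tc.
rewrite (edist_sym B A), (edist_sym A C) in ta.
rewrite (edist_sym C B), (edist_sym B A) in tb.
rewrite (edist_sym A C), (edist_sym C B) in tc.
pose proof (sq_edist B C) as ha; pose proof (sq_edist C A) as hb.
pose proof (sq_edist A B) as hc.
set (a := edist B C) in *; set (b := edist C A) in *; set (c := edist A B) in *.
set (D := (fst B - fst A) * (snd C - snd A) - (fst C - fst A) * (snd B - snd A)) in *.
(* Heron's formula, [D] being twice the signed area: as the product is nonzero, no triangle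
   inequality is an equality. *)
assert (heron : (a + b + c) * (b + c - a) * (c + a - b) * (a + b - c) = 4 * D ^ 2).
{ replace (_ * _ * _ * _)
    with (4 * b ^ 2 * c ^ 2 - (b ^ 2 + c ^ 2 - a ^ 2) ^ 2) by ring.
  rewrite ha, hb, hc; unfold D; ring. }
assert (hD : D ^ 2 <> 0) by (apply pow_nonzero; exact h).
exists ((b + c - a) / 2), ((c + a - b) / 2), ((a + b - c) / 2).
assert (b + c - a <> 0) by (intros e; rewrite e in heron; lra).
assert (c + a - b <> 0) by (intros e; rewrite e in heron; lra).
assert (a + b - c <> 0) by (intros e; rewrite e in heron; lra).
repeat split; lra.
Qed.

(** * Distances from X10 in the frame v, w *)

(* |al v + be w|^2 when |v|^2 = V, |w|^2 = W and v.w = -tau/2. *)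
Definition combo_sq (V W tau al be : R) : R :=
  al ^ 2 * V - al * be * tau + be ^ 2 * W.

(* X_i - X10 = (al v + be w) / d for (al, be, d) = coef i V rho tau, where
   V = |v|^2; only 1 <= i <= 9 is meaningful. *)
Definition coef (i : nat) (V rho tau : R) : R * R * R :=
  match i with
  | 1%nat => (1, 0, 1)
  | 2%nat => (1, 0, 3)
  | 3%nat => (0, 1, 1)
  | 4%nat => (1, -2, 1)
  | 5%nat => (1, -1, 2)
  | 6%nat => (2 * (V + 7 * rho + 4 * tau), - rho, 2 * V + 9 * rho + 6 * tau)
  | 7%nat => (11 * rho + 4 * tau, -4 * rho, 9 * rho + 4 * tau)
  | 8%nat => (-1, 0, 1)
  | _ => (- rho, 2 * rho, 9 * rho + 4 * tau)
  end.

Definition num (i : nat) (V W rho tau : R) : R :=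
  let '(al, be, _) := coef i V rho tau in combo_sq V W tau al be.

Definition den (i : nat) (V rho tau : R) : R := snd (coef i V rho tau).

Definition spieker_dist (i : nat) (V W rho tau : R) : R :=
  sqrt (num i V W rho tau) / den i V rho tau.

(** One Cartesian coordinate of X_n, from the same coordinate of the three vertices: vector
    identities are proved one coordinate at a time. *)
Definition center_coord (n : nat) (a b c t1 t2 t3 : R) : R :=
  let u := center_fun n a b c in
  let v := center_fun n b c a in
  let w := center_fun n c a b in
  (u * t1 + v * t2 + w * t3) / (u + v + w).


(** * The frame v, w in the Ravi variables *)

(* The side lengths are y + z, z + x, x + y. *)
Section Ravi.
Variables x y z : R.
Hypotheses (hx : 0 < x) (hy : 0 < y) (hz : 0 < z).

(** Here s = x + y + z, xyz = r^2 s and xy + yz + zx = r^2 + 4Rr. Thus [ravi_V] is (s^2 - 16Rr +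
    5r^2) / 4 and [ravi_W] is (4R^2 + 4Rr + 3r^2 - s^2) / 4, whose nonnegativity is Gerretsen's pair
    of inequalities. *)
Definition ravi_rho : R := x * y * z / (x + y + z).
Definition ravi_tau : R :=
  ((x + y + z) * (x * y + y * z + z * x) - 9 * (x * y * z)) / (4 * (x + y + z)).
Definition ravi_V : R :=
  ((x + y + z) ^ 3 - 4 * (x + y + z) * (x * y + y * z + z * x)
   + 9 * (x * y * z)) / (4 * (x + y + z)).
Definition ravi_W : R :=
  (((x + y + z) * (x * y + y * z + z * x) - x * y * z) ^ 2
     / (4 * (x + y + z) * (x * y * z))
   + 3 * (x * y * z) / (x + y + z)
   + ((x + y + z) * (x * y + y * z + z * x) - x * y * z) / (x + y + z)
   - (x + y + z) ^ 2) / 4.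

Lemma coord1 (t1 t2 t3 : R) :
  center_coord 1 (y + z) (z + x) (x + y) t1 t2 t3 =
  ((y + z) * t1 + (z + x) * t2 + (x + y) * t3) / (2 * (x + y + z)).
Proof. unfold center_coord, center_fun; f_equal; ring. Qed.

Lemma coord10 (t1 t2 t3 : R) :
  center_coord 10 (y + z) (z + x) (x + y) t1 t2 t3 =
  ((2 * x + y + z) * t1 + (2 * y + z + x) * t2 + (2 * z + x + y) * t3)
  / (4 * (x + y + z)).
Proof. unfold center_coord, center_fun; f_equal; ring. Qed.

Lemma coord3 (t1 t2 t3 : R) :
  center_coord 3 (y + z) (z + x) (x + y) t1 t2 t3 =
  ((y + z) ^ 2 * (x * (x + y + z) - y * z) * t1
   + (z + x) ^ 2 * (y * (x + y + z) - z * x) * t2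
   + (x + y) ^ 2 * (z * (x + y + z) - x * y) * t3)
  / (8 * (x + y + z) * (x * y * z)).
Proof.
unfold center_coord, center_fun; cbv zeta.
match goal with |- ?n / ?d = ?n' / ?d' =>
  replace n with (-2 * n') by ring; replace d with (-2 * d') by ring end.
field; repeat split; lra.
Qed.

Lemma coord_rel (i : nat) (t1 t2 t3 : R) : (1 <= i <= 9)%nat ->
  let X n := center_coord n (y + z) (z + x) (x + y) t1 t2 t3 in
  let '(al, be, d) := coef i ravi_V ravi_rho ravi_tau in
  X i - X 10%nat = (al * (X 1%nat - X 10%nat) + be * (X 3%nat - X 10%nat)) / d.
Proof.
intros hi; cbv beta zeta.
assert (q0 : x * y + y * z + z * x <> 0) by nra.
assert (q1 : (x + y + z) ^ 2 - (x * y + y * z + z * x) <> 0) by nra.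
rewrite coord1, coord3, coord10.
(* In turn r^2 + 4Rr, (s^2 - r^2 - 4Rr) / 2 and (s^2 + r^2) / 2: the first two are the denominators
   of X7, X9 and of X6, in a form visibly nonzero. *)
assert (E67 : 9 * ravi_rho + 4 * ravi_tau = x * y + y * z + z * x)
  by (unfold ravi_rho, ravi_tau; field; lra).
assert (EQ : 2 * ravi_V + 9 * ravi_rho + 6 * ravi_tau =
             ((x + y + z) ^ 2 - (x * y + y * z + z * x)) / 2)
  by (unfold ravi_V, ravi_rho, ravi_tau; field; lra).
assert (EY : 2 * (ravi_V + 7 * ravi_rho + 4 * ravi_tau) =
             ((x + y + z) ^ 2 + ravi_rho) / 2)
  by (unfold ravi_V, ravi_rho, ravi_tau; field; lra).
destruct i as [|[|[|[|[|[|[|[|[|[|i]]]]]]]]]]; try lia; unfold coef.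
- rewrite coord1; field; repeat split; lra.
- unfold center_coord, center_fun; field; repeat split; lra.
- rewrite coord3; field; repeat split; lra.
- unfold center_coord, center_fun; cbv zeta.
  (* The sum of the barycentric coordinates is factored, so that the side condition of [field]
     becomes provable; likewise in the cases below. *)
  match goal with |- _ / ?d - _ = _ =>
    replace d with (16 * (x + y + z) * (x * y * z)) by ring end.
  field; repeat split; lra.
- unfold center_coord, center_fun; cbv zeta.
  match goal with |- _ / ?d - _ = _ =>
    replace d with (-32 * (x + y + z) * (x * y * z)) by ring end.
  field; repeat split; lra.
- rewrite EQ, EY; unfold ravi_rho, center_coord, center_fun; cbv zeta.
  match goal with |- _ / ?d - _ = _ =>
    replace d with (2 * ((x + y + z) ^ 2 - (x * y + y * z + z * x))) by ring end.
  field; repeat split; nra.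
- replace (11 * ravi_rho + 4 * ravi_tau)
    with (x * y + y * z + z * x + 2 * ravi_rho) by lra.
  rewrite E67; unfold ravi_rho, center_coord, center_fun; cbv zeta.
  match goal with |- _ / ?d - _ = _ =>
    replace d with (4 * (x * y + y * z + z * x)) by ring end.
  field; repeat split; lra.
- unfold center_coord, center_fun; cbv zeta.
  match goal with |- _ / ?d - _ = _ =>
    replace d with (-2 * (x + y + z)) by ring end.
  field; repeat split; lra.
- rewrite E67; unfold ravi_rho, center_coord, center_fun; cbv zeta.
  match goal with |- _ / ?d - _ = _ =>
    replace d with (-4 * (x * y + y * z + z * x)) by ring end.
  field; repeat split; lra.
Qed.

(** Weights of sum zero describe a displacement, independent of the origin, so inner products depend
    on the squared sides only. *)
Lemma dot_combination (A B C : point) (d1 d2 d3 f1 f2 f3 : R) :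
  d1 + d2 + d3 = 0 -> f1 + f2 + f3 = 0 ->
  (d1 * fst A + d2 * fst B + d3 * fst C) * (f1 * fst A + f2 * fst B + f3 * fst C)
  + (d1 * snd A + d2 * snd B + d3 * snd C) * (f1 * snd A + f2 * snd B + f3 * snd C)
  = - ((d2 * f3 + d3 * f2) * edist B C ^ 2 + (d3 * f1 + d1 * f3) * edist C A ^ 2
       + (d1 * f2 + d2 * f1) * edist A B ^ 2) / 2.
Proof.
intros hd hf; rewrite !sq_edist.
replace d1 with (- d2 - d3) by lra; replace f1 with (- f2 - f3) by lra; field.
Qed.

(** Weights of the vertex A in v and w; those of B and C come from cyclic shifts of the
    arguments. *)
Definition weight_v (x y z : R) : R := (y + z - 2 * x) / (4 * (x + y + z)).
Definition weight_w (x y z : R) : R :=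
  (y + z) ^ 2 * (x * (x + y + z) - y * z) / (8 * (x + y + z) * (x * y * z))
  - (2 * x + y + z) / (4 * (x + y + z)).

Lemma displacement_gram (A B C : point) :
  edist B C = y + z -> edist C A = z + x -> edist A B = x + y ->
  let X n (t : point -> R) :=
    center_coord n (y + z) (z + x) (x + y) (t A) (t B) (t C) in
  let v (t : point -> R) := X 1%nat t - X 10%nat t in
  let w (t : point -> R) := X 3%nat t - X 10%nat t in
  v fst * v fst + v snd * v snd = ravi_V /\
  v fst * w fst + v snd * w snd = - ravi_tau / 2 /\
  w fst * w fst + w snd * w snd = ravi_W.
Proof.
intros ha hb hc X v w.
assert (hv : forall t, v t =
  weight_v x y z * t A + weight_v y z x * t B + weight_v z x y * t C).
{ intros t; unfold v, X, weight_v; rewrite coord1, coord10; field; repeat split; lra. }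
assert (hw : forall t, w t =
  weight_w x y z * t A + weight_w y z x * t B + weight_w z x y * t C).
{ intros t; unfold w, X, weight_w; rewrite coord3, coord10; field; repeat split; lra. }
assert (s1 : weight_v x y z + weight_v y z x + weight_v z x y = 0)
  by (unfold weight_v; field; repeat split; lra).
assert (s3 : weight_w x y z + weight_w y z x + weight_w z x y = 0)
  by (unfold weight_w; field; repeat split; lra).
rewrite !hv, !hw, !dot_combination, ha, hb, hc by assumption.
unfold ravi_V, ravi_W, ravi_tau, weight_v, weight_w.
repeat split; field; repeat split; lra.
Qed.

Lemma ravi_rho_pos : 0 < ravi_rho.
Proof.
unfold ravi_rho; apply Rdiv_lt_0_compat; [|lra].
repeat apply Rmult_lt_0_compat; assumption.
Qed.

(** Euler's inequality R >= 2r. *)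
Lemma ravi_tau_nonneg : 0 <= ravi_tau.
Proof.
unfold ravi_tau; apply Rle_mult_inv_pos; [|lra].
replace (_ - _) with (x * (y - z) ^ 2 + y * (z - x) ^ 2 + z * (x - y) ^ 2) by ring.
repeat apply Rplus_le_le_0_compat;
  (apply Rmult_le_pos; [lra | apply pow2_ge_0]).
Qed.

(** The terms in s^2 cancel in V + W, which leaves (R - r)(R - 2r). *)
Lemma ravi_sum :
  ravi_rho * (ravi_V + ravi_W) = ravi_tau ^ 2 + ravi_rho * ravi_tau.
Proof. unfold ravi_V, ravi_W, ravi_tau, ravi_rho; field; repeat split; lra. Qed.

End Ravi.

(** * From the triangle to four constrained numbers *)

Lemma edist_combination (S X1 X3 Y : point) (al be d V W tau : R) :
  0 < d ->
  fst Y - fst S = (al * (fst X1 - fst S) + be * (fst X3 - fst S)) / d ->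
  snd Y - snd S = (al * (snd X1 - snd S) + be * (snd X3 - snd S)) / d ->
  (fst X1 - fst S) * (fst X1 - fst S) + (snd X1 - snd S) * (snd X1 - snd S) = V ->
  (fst X1 - fst S) * (fst X3 - fst S) + (snd X1 - snd S) * (snd X3 - snd S) = - tau / 2 ->
  (fst X3 - fst S) * (fst X3 - fst S) + (snd X3 - snd S) * (snd X3 - snd S) = W ->
  edist S Y = sqrt (combo_sq V W tau al be) / d.
Proof.
intros hd h1 h2 hV hP hW.
rewrite <- (sqrt_pow2 d) at 1 by lra.
rewrite <- sqrt_div_alt by (apply pow_lt; exact hd).
unfold edist, dist_euc; f_equal.
rewrite (Rsqr_neg_minus (fst S)), (Rsqr_neg_minus (snd S)), h1, h2.
assert (ht : tau = -2 * (- tau / 2)) by field.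
unfold Rsqr, combo_sq; rewrite ht, <- hV, <- hP, <- hW; field; lra.
Qed.

Lemma den_pos (i : nat) (V rho tau : R) :
  0 <= V -> 0 < rho -> 0 <= tau -> 0 < den i V rho tau.
Proof.
intros; unfold den.
destruct i as [|[|[|[|[|[|[|[|[|[|i]]]]]]]]]]; simpl; lra.
Qed.

Lemma spieker_frame (A B C : point) : nondegenerate A B C ->
  exists V W rho tau : R,
    0 <= V /\ 0 <= W /\ 0 < rho /\ 0 <= tau /\
  rho * (V + W) = tau ^ 2 + rho * tau /\ tau ^ 2 / 4 <= V * W /\
  forall i, (1 <= i <= 9)%nat ->
      center_dist A B C 10 i = spieker_dist i V W rho tau.
Proof.
intros h; destruct (ravi _ _ _ h) as (x & y & z & hx & hy & hz & ha & hb & hc).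
destruct (displacement_gram x y z hx hy hz A B C ha hb hc) as (gV & gP & gW).
exists (ravi_V x y z), (ravi_W x y z), (ravi_rho x y z), (ravi_tau x y z).
assert (hV : 0 <= ravi_V x y z)
  by (rewrite <- gV; apply Rplus_le_le_0_compat; apply Rle_0_sqr).
assert (hW : 0 <= ravi_W x y z)
  by (rewrite <- gW; apply Rplus_le_le_0_compat; apply Rle_0_sqr).
assert (hr := ravi_rho_pos x y z hx hy hz).
assert (ht := ravi_tau_nonneg x y z hx hy hz).
split; [exact hV|]; split; [exact hW|]; split; [exact hr|]; split; [exact ht|].
split; [apply ravi_sum; assumption|]; split.
{ replace (_ / 4) with ((- ravi_tau x y z / 2) ^ 2) by field.
  rewrite <- gV, <- gP, <- gW.
  (* Cauchy-Schwarz for v and w, by Lagrange's identity. *)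
  match goal with |- (?a * ?b + ?c * ?d) ^ 2 <= _ =>
    generalize (pow2_ge_0 (a * d - b * c)); lra end. }
intros i hi; unfold spieker_dist, num.
assert (hd := den_pos i _ _ _ hV hr ht); unfold den in *.
assert (r1 := coord_rel x y z hx hy hz i (fst A) (fst B) (fst C) hi).
assert (r2 := coord_rel x y z hx hy hz i (snd A) (snd B) (snd C) hi).
destruct (coef i _ _ _) as [[al be] d]; simpl in hd |- *.
unfold center_dist.
apply (edist_combination _ (center A B C 1) (center A B C 3)); try exact hd;
unfold center; rewrite ha, hb, hc; assumption.
Qed.

(** * Parametrization of the constraints *)

Definition V_of (x p q : R) : R := (p + q) * x ^ 2 + 4 * (1 + x) * p.
Definition W_of (x p q : R) : R := (p + q) * x ^ 2 + 4 * (1 + x) * q.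
Definition rho_of (x p q : R) : R := (p + q) * (x * (x + 2)) ^ 2.
Definition tau_of (x p q : R) : R := 2 * (p + q) * (x * (x + 2)).

(* With d = R - 2r and r = sqrt rho, these are p + q = d^2 / 4 and
   x (x + 2) = 2 r / d. *)
Lemma parametrization (V W rho tau : R) :
  0 <= V -> 0 <= W -> 0 < rho -> 0 < tau ->
  rho * (V + W) = tau ^ 2 + rho * tau -> tau ^ 2 / 4 <= V * W ->
  exists x p q : R, 0 < x /\ 0 <= p /\ 0 <= q /\ 0 < p + q /\
    V = V_of x p q /\ W = W_of x p q /\ rho = rho_of x p q /\ tau = tau_of x p q.
Proof.
intros hV hW hr ht hsum hcs.
assert (hy : 0 < 2 * rho / tau) by (apply Rdiv_lt_0_compat; lra).
set (u := sqrt (1 + 2 * rho / tau)).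
assert (hu2 : u ^ 2 = 1 + 2 * rho / tau) by (apply pow2_sqrt; lra).
assert (hu : 1 < u)
  by (apply (Rsqr_incrst_0 1 u); [unfold Rsqr; lra | lra | apply sqrt_pos]).
set (x := u - 1); set (s := tau ^ 2 / (4 * rho)).
assert (hs : 0 < s) by (apply Rdiv_lt_0_compat; [apply pow_lt|]; lra).
assert (hx : 0 < x) by (unfold x; lra).
assert (hxy : x * (x + 2) = 2 * rho / tau) by (unfold x; lra).
assert (etau : tau = 2 * s * (x * (x + 2))) by (rewrite hxy; unfold s; field; lra).
assert (erho : rho = s * (x * (x + 2)) ^ 2) by (rewrite hxy; unfold s; field; lra).
assert (esum : V + W = s * (2 * x ^ 2 + 4 * (1 + x))).
{ apply (Rmult_eq_reg_l rho); [|lra]; rewrite hsum.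
  rewrite erho, etau; ring. }
set (p := (V - s * x ^ 2) / (4 * (1 + x))).
set (q := (W - s * x ^ 2) / (4 * (1 + x))).
assert (epq : p + q = s).
{ unfold p, q; replace W with (s * (2 * x ^ 2 + 4 * (1 + x)) - V) by lra.
  field; lra. }
(* Since x^4 + 4(1 + x)x^2 = (x(x + 2))^2, the Cauchy-Schwarz gap is 16(1 + x)^2 p q. So [p] and [q]
   do not have opposite signs, and their sum [s] is positive. *)
assert (hpq : 0 <= p * q).
{ replace (p * q) with ((V * W - tau ^ 2 / 4) / (16 * (1 + x) ^ 2)).
  - apply Rle_mult_inv_pos; [lra|].
    apply Rmult_lt_0_compat; [lra | apply pow_lt; lra].
  - unfold p, q; rewrite etau.
    replace W with (s * (2 * x ^ 2 + 4 * (1 + x)) - V) by lra.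
    field; lra. }
exists x, p, q.
split; [exact hx|]; split; [nra|]; split; [nra|]; split; [lra|].
unfold V_of, W_of, rho_of, tau_of; rewrite epq.
repeat split; try assumption; unfold p, q; field; lra.
Qed.

(** * Distance ratios as polynomial inequalities *)

(** Complete the square after multiplying by [V]; if [V = 0], Cauchy-Schwarz forces [tau = 0]. *)
Lemma num_nonneg (i : nat) (V W rho tau : R) :
  0 <= V -> 0 <= W -> tau ^ 2 / 4 <= V * W -> 0 <= num i V W rho tau.
Proof.
intros hV hW hcs; unfold num; destruct (coef i V rho tau) as [[al be] d].
unfold combo_sq.
destruct (Req_dec V 0) as [-> | V0].
- assert (tau = 0) as -> by nra; nra.
- apply (Rmult_le_reg_l V); [lra|]; rewrite Rmult_0_r.
  replace (V * _) with
    ((al * V - be * tau / 2) ^ 2 + be ^ 2 * (V * W - tau ^ 2 / 4)) by field.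
  apply Rplus_le_le_0_compat; [apply pow2_ge_0|].
  apply Rmult_le_pos; [apply pow2_ge_0 | lra].
Qed.

(** The bound [a * D(10,i) <= b * D(10,j)], squared and cleared of denominators, over the
    parameters. *)
Definition ratio_bound (a b : R) (i j : nat) : Prop :=
  forall x p q : R, 0 < x -> 0 <= p -> 0 <= q ->
    let V := V_of x p q in let W := W_of x p q in
    let rho := rho_of x p q in let tau := tau_of x p q in
    a ^ 2 * num i V W rho tau * den j V rho tau ^ 2
    <= b ^ 2 * num j V W rho tau * den i V rho tau ^ 2.

Lemma spieker_dist_le (a b : R) (i j : nat) (V W rho tau : R) :
  0 <= V -> 0 <= W -> 0 < rho -> 0 <= tau ->
  rho * (V + W) = tau ^ 2 + rho * tau -> tau ^ 2 / 4 <= V * W ->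
  0 <= a -> 0 <= b -> ratio_bound a b i j ->
  a * spieker_dist i V W rho tau <= b * spieker_dist j V W rho tau.
Proof.
intros hV hW hr ht hsum hcs ha hb h; unfold spieker_dist.
assert (di := den_pos i _ _ _ hV hr ht).
assert (dj := den_pos j _ _ _ hV hr ht).
assert (key : a ^ 2 * num i V W rho tau * den j V rho tau ^ 2
              <= b ^ 2 * num j V W rho tau * den i V rho tau ^ 2).
{ destruct (Rle_lt_or_eq_dec _ _ ht) as [t0 | t0].
  - destruct (parametrization _ _ _ _ hV hW hr t0 hsum hcs)
      as (x & p & q & hx & hp & hq & _ & -> & -> & -> & ->).
    apply h; assumption.
  (* The equilateral case R = 2r lies outside the parametrization; there all the distances
     vanish. *)
  - subst tau; assert (V + W = 0) by nra.
    assert (V = 0) as -> by lra; assert (W = 0) as -> by lra.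
    unfold num, combo_sq.
    destruct (coef i _ _ _) as [[al be] d]; destruct (coef j _ _ _) as [[al' be'] d'].
    right; field. }
apply (Rmult_le_reg_r (den i V rho tau * den j V rho tau)).
{ apply Rmult_lt_0_compat; assumption. }
replace (_ * (_ / _) * _) with (a * den j V rho tau * sqrt (num i V W rho tau))
  by (field; lra).
replace (_ * (_ / _) * _) with (b * den i V rho tau * sqrt (num j V W rho tau))
  by (field; lra).
apply Rsqr_incr_0.
- rewrite !Rsqr_mult, !Rsqr_sqrt by (apply num_nonneg; assumption).
  unfold Rsqr; lra.
- apply Rmult_le_pos; [apply Rmult_le_pos; lra | apply sqrt_pos].
- apply Rmult_le_pos; [apply Rmult_le_pos; lra | apply sqrt_pos].
Qed.

Ltac poly_nonneg :=
  ring_simplify;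
  repeat apply Rplus_le_le_0_compat;
  repeat apply Rmult_le_pos; try apply pow_le; lra.

Ltac unfold_param :=
  cbv beta iota zeta delta [num den coef snd combo_sq V_of W_of rho_of tau_of].

Lemma le_of_diff (u v : R) : 0 <= v - u -> u <= v.
Proof. lra. Qed.

Ltac ratio_bound_by_coefficients :=
  intros x p q hx hp hq; unfold_param; apply le_of_diff; poly_nonneg.

(** * The three bounds sharp at an interior isosceles shape *)

(* The zero-subscripted values are those at an isosceles endpoint p = 0 or
   q = 0, where the irrational constant a is sharp; elsewhere a^2 can be replaced
   by the slightly larger rational c. *)
Lemma endpoint_reduction (a c N N0 D D0 M M0 E E0 : R) :
  a ^ 2 <= c -> N0 * D0 <= N * D -> a ^ 2 * (N0 * D0) <= M0 * E0 ->
  c * (N * D - N0 * D0) <= M * E - M0 * E0 ->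
  a ^ 2 * N * D <= 1 ^ 2 * M * E.
Proof. intros; nra. Qed.

Lemma mul_square_le (k s u v : R) :
  0 <= k -> 0 <= s -> 0 <= u -> k * u <= v -> k ^ 2 * (s * u ^ 2) <= s * v ^ 2.
Proof.
intros hk hs hu h.
replace (k ^ 2 * (s * u ^ 2)) with (s * (k * u) ^ 2) by ring.
apply Rmult_le_compat_l; [exact hs|]; apply pow_incr.
split; [apply Rmult_le_pos|]; assumption.
Qed.

Lemma sqrt2_sq : sqrt 2 * sqrt 2 = 2.
Proof. apply sqrt_sqrt; lra. Qed.

Lemma sqrt2_bounds : 14142 / 10000 <= sqrt 2 <= 14143 / 10000.
Proof. pose proof sqrt2_sq; pose proof (sqrt_pos 2); split; nra. Qed.

Lemma ratio_bound_6_1 : ratio_bound (2 - sqrt 2) 1 6 1.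
Proof.
destruct sqrt2_bounds as [lo hi]; pose proof sqrt2_sq as s2.
intros x p q hx hp hq; cbv zeta.
(* Compare with the endpoint [p = 0]; 0.3432 is just above (2 - sqrt 2)^2 = 6 - 4 sqrt 2. *)
apply (endpoint_reduction _ (3432 / 10000) _
  (num 6 (V_of x 0 q) (W_of x 0 q) (rho_of x 0 q) (tau_of x 0 q)) _
  (den 1 (V_of x 0 q) (rho_of x 0 q) (tau_of x 0 q) ^ 2) _
  (num 1 (V_of x 0 q) (W_of x 0 q) (rho_of x 0 q) (tau_of x 0 q)) _
  (den 6 (V_of x 0 q) (rho_of x 0 q) (tau_of x 0 q) ^ 2)).
- nra.
- apply le_of_diff; unfold_param; poly_nonneg.
(* For [p = 0] Cauchy-Schwarz is an equality, v and w are parallel, and each squared length is [q]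
   times a square; [u] and [v] are the roots of these squares. *)
- set (u := q * x ^ 2 * (15 * x ^ 3 + 62 * x ^ 2 + 86 * x + 40)).
  set (v := q * x ^ 2 * (9 * x ^ 3 + 36 * x ^ 2 + 50 * x + 24)).
  replace (num 6 _ _ _ _ * _) with (q * u ^ 2) by (unfold u; unfold_param; ring).
  replace (num 1 _ _ _ _ * _) with (q * v ^ 2) by (unfold v; unfold_param; ring).
  apply mul_square_le; [lra | exact hq | |]; unfold u, v.
  + poly_nonneg.
  + apply le_of_diff.
    (* The second summand vanishes because sqrt 2 squares to 2. The square locates equality at x =
       sqrt 2. *)
    replace (_ - _) with
      (q * x ^ 2 * ((5 * sqrt 2 - 7) * (3 * x + 4) * (x - sqrt 2) ^ 2
         + (sqrt 2 * sqrt 2 - 2)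
           * (30 * x ^ 2 + (61 - 15 * sqrt 2) * x + 28 - 20 * sqrt 2))) by ring.
    rewrite s2, Rminus_diag, Rmult_0_l, Rplus_0_r.
    repeat first [apply pow2_ge_0 | apply Rmult_le_pos]; lra.
- apply (Rmult_le_reg_l 10000); [lra|].
  rewrite <- Rmult_assoc.
  replace (10000 * (3432 / 10000)) with 3432 by field.
  apply le_of_diff; unfold_param; poly_nonneg.
Qed.

Lemma ratio_bound_9_5 : ratio_bound (3 / 2 + sqrt 2) 1 9 5.
Proof.
destruct sqrt2_bounds as [lo hi]; pose proof sqrt2_sq as s2.
intros x p q hx hp hq; cbv zeta.
(* Again the endpoint is [p = 0]; 8.5 is just above (3/2 + sqrt 2)^2. *)
apply (endpoint_reduction _ (85 / 10) _
  (num 9 (V_of x 0 q) (W_of x 0 q) (rho_of x 0 q) (tau_of x 0 q)) _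
  (den 5 (V_of x 0 q) (rho_of x 0 q) (tau_of x 0 q) ^ 2) _
  (num 5 (V_of x 0 q) (W_of x 0 q) (rho_of x 0 q) (tau_of x 0 q)) _
  (den 9 (V_of x 0 q) (rho_of x 0 q) (tau_of x 0 q) ^ 2)).
- nra.
- apply le_of_diff; unfold_param; poly_nonneg.
- set (y := x * (x + 2)).
  set (u := 2 * q * y ^ 2 * (3 * x + 4)).
  set (v := 2 * q * y * (x + 1) * (9 * y + 8)).
  replace (num 9 _ _ _ _ * _) with (q * u ^ 2) by (unfold u, y; unfold_param; ring).
  replace (num 5 _ _ _ _ * _) with (q * v ^ 2) by (unfold v, y; unfold_param; ring).
  apply mul_square_le; [lra | exact hq | |]; unfold u, v, y.
  + poly_nonneg.
  + apply le_of_diff.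
    (* Equality occurs at x = 2 / (sqrt 2 - 1). *)
    replace (_ - _) with
      (q * (x * (x + 2)) * (3 * x + 4)
       * (((sqrt 2 - 1) * x - 2) ^ 2 - (sqrt 2 * sqrt 2 - 2) * x ^ 2)) by field.
    rewrite s2, Rminus_diag, Rmult_0_l, Rminus_0_r.
    repeat first [apply pow2_ge_0 | apply Rmult_le_pos]; lra.
- apply (Rmult_le_reg_l 10); [lra|].
  rewrite <- Rmult_assoc.
  replace (10 * (85 / 10)) with 85 by field.
  apply le_of_diff; unfold_param; poly_nonneg.
Qed.

(** The relevant endpoint is [q = 0]. There both sides share the factor [m], and what remains is the
    cubic inequality taken as hypothesis. The constant 0.2078 exceeds 0.4558^2. *)
Lemma ratio_bound_6_5 (c : R) : 0 <= c <= 4558 / 10000 ->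
  (forall x, 0 <= x ->
    c * ((x + 2) * (5 * x ^ 2 + 6 * x + 2)) <= (x + 1) * (3 * x ^ 2 + 4 * x + 2)) ->
  ratio_bound c 1 6 5.
Proof.
intros hc h x p q hx hp hq; cbv zeta.
apply (endpoint_reduction _ (2078 / 10000) _
  (num 6 (V_of x p 0) (W_of x p 0) (rho_of x p 0) (tau_of x p 0)) _
  (den 5 (V_of x p 0) (rho_of x p 0) (tau_of x p 0) ^ 2) _
  (num 5 (V_of x p 0) (W_of x p 0) (rho_of x p 0) (tau_of x p 0)) _
  (den 6 (V_of x p 0) (rho_of x p 0) (tau_of x p 0) ^ 2)).
- nra.
- apply le_of_diff; unfold_param; poly_nonneg.
- set (m := 2 * p * (x + 2) * (3 * x + 2)).
  set (u := m * ((x + 2) * (5 * x ^ 2 + 6 * x + 2))).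
  set (v := m * ((x + 1) * (3 * x ^ 2 + 4 * x + 2))).
  replace (num 6 _ _ _ _ * _) with (p * u ^ 2) by (unfold u, m; unfold_param; ring).
  replace (num 5 _ _ _ _ * _) with (p * v ^ 2) by (unfold v, m; unfold_param; ring).
  apply mul_square_le; [lra | exact hp | |]; unfold u, v.
  + unfold m; poly_nonneg.
  + rewrite (Rmult_comm m), <- Rmult_assoc, (Rmult_comm m).
    apply Rmult_le_compat_r; [unfold m; poly_nonneg | apply h; lra].
- apply (Rmult_le_reg_l 10000); [lra|].
  rewrite <- Rmult_assoc.
  replace (10000 * (2078 / 10000)) with 2078 by field.
  apply le_of_diff; unfold_param; poly_nonneg.
Qed.

(** * The quartic and its smallest positive root *)

(* The quartic is the discriminant, in c, of the difference of the two sides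
   as a cubic in x (up to the factor -8); hence the square in its value at n / m below. *)
Lemma ratio_lower_bound_root (c : R) :
  (forall z, 0 <= z < c -> 0 < 50 * z^4 - 72 * z^3 + 22 * z^2 - 2 * z + 1) ->
  forall x, 0 <= x ->
    c * ((x + 2) * (5 * x ^ 2 + 6 * x + 2)) <= (x + 1) * (3 * x ^ 2 + 4 * x + 2).
Proof.
intros hc x hx.
set (n := (x + 1) * (3 * x ^ 2 + 4 * x + 2)).
set (m := (x + 2) * (5 * x ^ 2 + 6 * x + 2)).
assert (hn : 0 <= n) by (unfold n; poly_nonneg).
assert (hm : 0 < m).
{ unfold m; apply Rmult_lt_0_compat; [lra|]; generalize (pow2_ge_0 x); lra. }
destruct (Rle_or_lt (c * m) n) as [le | lt]; [exact le | exfalso].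
assert (hz : 0 <= n / m < c).
{ split; [apply Rle_mult_inv_pos; assumption|].
  apply (Rmult_lt_reg_r m); [exact hm|]; unfold Rdiv.
  rewrite Rmult_assoc, Rinv_l, Rmult_1_r; lra. }
specialize (hc _ hz).
(* For c = n / m the cubic has the root [x], so its discriminant is its squared derivative at [x]
   times the discriminant of the quadratic cofactor. The squared polynomial is n'm - nm'; the other
   one is positive for x >= 0. *)
assert (id : 50 * (n / m) ^ 4 - 72 * (n / m) ^ 3 + 22 * (n / m) ^ 2 - 2 * (n / m) + 1
   = - ((13 * x ^ 4 + 24 * x ^ 3 + 8 * x ^ 2 - 8 * x - 4) ^ 2
        * (5 * x ^ 4 + 26 * x ^ 3 + 38 * x ^ 2 + 24 * x + 6) / m ^ 4)).
{ unfold n, m; field; fold m; split; [generalize (pow2_ge_0 x) |]; lra. }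
rewrite id in hc.
apply (Rlt_not_le _ _ hc).
apply Ropp_le_cancel; rewrite Ropp_0, Ropp_involutive.
apply Rle_mult_inv_pos; [|apply pow_lt; exact hm].
apply Rmult_le_pos; [apply pow2_ge_0 | poly_nonneg].
Qed.

Definition C10_poly (x : R) : R := 50 * x^4 - 72 * x^3 + 22 * x^2 - 2 * x + 1.

Lemma C10_exists : exists c : R,
  C10_poly c = 0 /\ 455650 / 1000000 <= c <= 455750 / 1000000 /\
  forall z, 0 <= z < c -> 0 < C10_poly z.
Proof.
(* [IVT] expects a change from negative to positive, while the quartic decreases through this
   root. *)
destruct (IVT (fun x => - C10_poly x) (455650 / 1000000) (455750 / 1000000))
  as (c & hc & c0).
- unfold C10_poly; intros t; reg.
- lra.
- unfold C10_poly; lra.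
- unfold C10_poly; lra.
- assert (pc : C10_poly c = 0) by lra.
  exists c; split; [exact pc|]; split; [exact hc|]; intros z hz.
  (* Subtracting the value 0 at [c] splits off c - z; the cofactor is grouped by powers of [z], each
     group being nonnegative and the constant one positive. *)
  replace (C10_poly z) with
    ((c - z) * (z ^ 2 * (72 - 50 * c - 50 * z) + z * (72 * c - 22 - 50 * c ^ 2)
                + (2 - c * (22 - 72 * c + 50 * c ^ 2)))).
  + apply Rmult_lt_0_compat; [lra|].
    assert (0 <= z ^ 2 * (72 - 50 * c - 50 * z))
      by (apply Rmult_le_pos; [apply pow2_ge_0 | lra]).
    assert (0 <= z * (72 * c - 22 - 50 * c ^ 2)) by (apply Rmult_le_pos; nra).
    assert (0 < 2 - c * (22 - 72 * c + 50 * c ^ 2)) by nra.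
    lra.
  + transitivity (C10_poly z - C10_poly c); [unfold C10_poly; ring | lra].
Qed.

(** * Rational bounds and assembly *)

(** The first four give the equalities among the distances to X1, X2 and X8, through which the
    bounds for X2 and X8 reduce to those for X1. *)
Lemma rational_ratio_bounds :
  ratio_bound 1 3 1 2 /\ ratio_bound 3 1 2 1 /\
  ratio_bound 1 1 1 8 /\ ratio_bound 1 1 8 1 /\
  ratio_bound 1 1 1 4 /\ ratio_bound 1 2 1 5 /\ ratio_bound 1 1 1 6 /\
  ratio_bound 1 1 9 1 /\ ratio_bound 1 1 1 7 /\ ratio_bound 1 3 7 1 /\
  ratio_bound 2 1 3 4 /\ ratio_bound 1 2 3 5 /\ ratio_bound 2 1 9 3 /\
  ratio_bound 2 1 5 4 /\ ratio_bound 1 4 4 5 /\ ratio_bound 1 1 6 4 /\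
  ratio_bound 1 1 7 4 /\ ratio_bound 9 1 9 4 /\ ratio_bound 1 2 7 5 /\
  ratio_bound 5 9 7 6 /\ ratio_bound 3 4 6 7 /\ ratio_bound 5 3 9 6 /\
  ratio_bound 3 1 9 7.
Proof. repeat split; ratio_bound_by_coefficients. Qed.

Theorem theorem10 :
  exists C10 : R,
    smallest_positive_root
      (fun x : R => 50 * x^4 - 72 * x^3 + 22 * x^2 - 2 * x + 1) C10 /\
    Rabs (C10 - 4557 / 10000) <= 5 / 100000 /\
    forall A B C : point, nondegenerate A B C ->
      center_dist A B C 10 1 = 3 * center_dist A B C 10 2 /\
      center_dist A B C 10 1 <= 1 * center_dist A B C 10 4 /\
      center_dist A B C 10 1 <= 2 * center_dist A B C 10 5 /\
      (2 - sqrt 2) * center_dist A B C 10 6 <= center_dist A B C 10 1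
        <= 1 * center_dist A B C 10 6 /\
      (1 / 3) * center_dist A B C 10 7 <= center_dist A B C 10 1
        <= 1 * center_dist A B C 10 7 /\
      center_dist A B C 10 1 = 1 * center_dist A B C 10 8 /\
      1 * center_dist A B C 10 9 <= center_dist A B C 10 1 /\
      center_dist A B C 10 2 <= (1 / 3) * center_dist A B C 10 4 /\
      center_dist A B C 10 2 <= (2 / 3) * center_dist A B C 10 5 /\
      (1 / 3 * (2 - sqrt 2)) * center_dist A B C 10 6 <= center_dist A B C 10 2
        <= (1 / 3) * center_dist A B C 10 6 /\
      (1 / 9) * center_dist A B C 10 7 <= center_dist A B C 10 2
        <= (1 / 3) * center_dist A B C 10 7 /\
      center_dist A B C 10 2 = (1 / 3) * center_dist A B C 10 8 /\
      (1 / 3) * center_dist A B C 10 9 <= center_dist A B C 10 2 /\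
      center_dist A B C 10 3 <= (1 / 2) * center_dist A B C 10 4 /\
      center_dist A B C 10 3 <= 2 * center_dist A B C 10 5 /\
      2 * center_dist A B C 10 9 <= center_dist A B C 10 3 /\
      2 * center_dist A B C 10 5 <= center_dist A B C 10 4
        <= 4 * center_dist A B C 10 5 /\
      1 * center_dist A B C 10 6 <= center_dist A B C 10 4 /\
      1 * center_dist A B C 10 7 <= center_dist A B C 10 4 /\
      1 * center_dist A B C 10 8 <= center_dist A B C 10 4 /\
      9 * center_dist A B C 10 9 <= center_dist A B C 10 4 /\
      C10 * center_dist A B C 10 6 <= center_dist A B C 10 5 /\
      (1 / 2) * center_dist A B C 10 7 <= center_dist A B C 10 5 /\
      (1 / 2) * center_dist A B C 10 8 <= center_dist A B C 10 5 /\
      (3 / 2 + sqrt 2) * center_dist A B C 10 9 <= center_dist A B C 10 5 /\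
      (5 / 9) * center_dist A B C 10 7 <= center_dist A B C 10 6
        <= (4 / 3) * center_dist A B C 10 7 /\
      1 * center_dist A B C 10 8 <= center_dist A B C 10 6
        <= (1 + 1 / sqrt 2) * center_dist A B C 10 8 /\
      (5 / 3) * center_dist A B C 10 9 <= center_dist A B C 10 6 /\
      1 * center_dist A B C 10 8 <= center_dist A B C 10 7
        <= 3 * center_dist A B C 10 8 /\
      3 * center_dist A B C 10 9 <= center_dist A B C 10 7 /\
      1 * center_dist A B C 10 9 <= center_dist A B C 10 8.
Proof.
destruct C10_exists as (C10 & root & hC & hpos).
exists C10; split; [|split].
- split; [lra|]; split; [exact root|]; intros z hz pz.
  destruct (Rle_or_lt C10 z) as [le | lt]; [exact le|].
  specialize (hpos z); unfold C10_poly in hpos; lra.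
- apply Rabs_le; lra.
- intros A B C h.
  destruct (spieker_frame A B C h)
    as (V & W & rho & tau & hV & hW & hr & ht & hsum & hcs & hd).
  rewrite !hd by lia.
  assert (le : forall a b i j, 0 <= a -> 0 <= b -> ratio_bound a b i j ->
      a * spieker_dist i V W rho tau <= b * spieker_dist j V W rho tau)
    by (intros; apply spieker_dist_le; assumption).
  destruct sqrt2_bounds as [lo hi].
  assert (b61 : (2 - sqrt 2) * spieker_dist 6 V W rho tau
                <= 1 * spieker_dist 1 V W rho tau)
    by (apply le; [lra | lra | exact ratio_bound_6_1]).
  assert (b95 : (3 / 2 + sqrt 2) * spieker_dist 9 V W rho tau
                <= 1 * spieker_dist 5 V W rho tau)
    by (apply le; [lra | lra | exact ratio_bound_9_5]).
  assert (b65 : C10 * spieker_dist 6 V W rho tau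
                <= 1 * spieker_dist 5 V W rho tau).
  { apply le; [lra | lra |]; apply ratio_bound_6_5; [lra|].
    apply ratio_lower_bound_root; exact hpos. }
  pose proof rational_ratio_bounds as H.
  repeat match goal with
  | H : _ /\ _ |- _ => destruct H
  | H : ratio_bound ?a ?b ?i ?j |- _ =>
      assert (a * spieker_dist i V W rho tau <= b * spieker_dist j V W rho tau)
        by (apply le; [lra | lra | exact H]); clear H
  end.
  clear hd le hV hW hr ht hsum hcs.
  assert (inv : 1 / sqrt 2 = sqrt 2 / 2).
  { pose proof sqrt2_sq; apply (Rmult_eq_reg_r (sqrt 2)); [|lra].
    replace (1 / sqrt 2 * sqrt 2) with 1 by (field; lra); lra. }
  rewrite inv.
  (* This is [b61] again: (1 + sqrt 2 / 2)(2 - sqrt 2) = 1. *)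
  assert (b68 : spieker_dist 6 V W rho tau
                <= (1 + sqrt 2 / 2) * spieker_dist 1 V W rho tau).
  { apply (Rmult_le_compat_l (1 + sqrt 2 / 2)) in b61; [|lra].
    replace ((1 + sqrt 2 / 2) * ((2 - sqrt 2) * spieker_dist 6 V W rho tau)) with
     (spieker_dist 6 V W rho tau * (2 - (sqrt 2 * sqrt 2) / 2)) in b61 by field.
    rewrite sqrt2_sq in b61; lra. }
  assert (e8 : spieker_dist 8 V W rho tau = spieker_dist 1 V W rho tau) by lra.
  assert (e2 : spieker_dist 1 V W rho tau = 3 * spieker_dist 2 V W rho tau) by lra.
  rewrite e8, e2 in *; repeat split; lra.
Qed.
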